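(* Let $0<\alpha<1$, let $I\subset\mathbb{R}$ be an interval, $t_0\in I$, let $A$ be an $n\times n$ matrix function continuous on $I$, and let $x_0\in\mathbb{R}^n$. Assume that the generalized Peano--Baker series $\Phi(t,t_0)=\sum_{k=0}^{\infty}{}_{t_0}J_t^{k\circ\alpha}A(t)$ converges uniformly in $t\in I$, $t>t_0$. Then a solution to the initial value problem $${}_{t_0}D_t^{\alpha}x(t)=A(t)x(t),\quad t\in\mathring{I},\ t>t_0,\qquad {}_{t_0}J_t^{1-\alpha}x(t)\big|_{t=t_0}=x_0,$$ is given by $$x(t)=\Phi(t,t_0)x_0 .$$
   Context: $\mathring{I}$ is the interior of $I$; throughout $t_0,t\in I$, $t>t_0$. The Riemann--Liouville fractional integral of order $\beta>0$ and derivative of order $\alpha\in(0,1)$ are $${}_{t_0}J_t^{\beta}f(t)=\frac{1}{\Gamma(\beta)}\int_{t_0}^t(t-\tau)^{\beta-1}f(\tau)\,d\tau,\qquad {}_{t_0}D_t^{\alpha}f(t)=\frac{d}{dt}\,{}_{t_0}J_t^{1-\alpha}f(t),$$ applied entrywise to vector and matrix functions. The value at $t=t_0$ of ${}_{t_0}J_t^{1-\alpha}x(t)$ is understood as the limit $t\to t_0+$. State-transition matrix: $\Phi(t,t_0)=\sum_{k=0}^{\infty}{}_{t_0}J_t^{k\circ\alpha}A(t)$, where, with $\mathrm{Id}$ the $n\times n$ identity matrix, $${}_{t_0}J_t^{0\circ\alpha}A(t)=\frac{(t-t_0)^{\alpha-1}}{\Gamma(\alpha)}\mathrm{Id},\qquad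 {}_{t_0}J_t^{(k+1)\circ\alpha}A(t)={}_{t_0}J_t^{\alpha}\bigl(A(t)\,{}_{t_0}J_t^{k\circ\alpha}A(t)\bigr),\quad k=0,1,\ldots$$ *)

(* Defs.v *)
From HB Require Import structures.
From mathcomp Require Import all_boot all_order all_algebra.
From mathcomp Require Import all_classical all_reals all_analysis.

Set Implicit Arguments.
Unset Strict Implicit.
Unset Printing Implicit Defensive.

Import Order.TTheory GRing.Theory Num.Theory.
Import numFieldNormedType.Exports.

Local Open Scope classical_set_scope.
Local Open Scope ring_scope.

Section FractionalCalculus.
Context {R : realType}.

Definition Gamma (s : R) : R :=
  \int[lebesgue_measure]_(u in `]0, +oo[) (u `^ (s - 1) * expR (- u)).

Definition RL_kernel (beta : R) (f : R -> R) (t tau : R) : R :=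
  (t - tau) `^ (beta - 1) * f tau.

(* [Rintegral] is total, with a junk value on non-integrable functions, so
   the existence of the fractional integral is a separate predicate. *)
Definition RLint_exists (t0 beta : R) (f : R -> R) (t : R) : Prop :=
  lebesgue_measure.-integrable `]t0, t[ (EFin \o RL_kernel beta f t).

Definition RLint (t0 beta : R) (f : R -> R) (t : R) : R :=
  (Gamma beta)^-1 *
  \int[lebesgue_measure]_(tau in `]t0, t[) RL_kernel beta f t tau.

Definition RLderive (t0 alpha : R) (f : R -> R) : R -> R :=
  derive1 (RLint t0 (1 - alpha) f).

Definition RLint_mx m n (t0 beta : R) (F : R -> 'M[R]_(m, n)) (t : R) :
    'M[R]_(m, n) :=
  \matrix_(i, j) RLint t0 beta (fun s => F s i j) t.

Definition RLderive_mx m n (t0 alpha : R) (F : R -> 'M[R]_(m, n)) (t : R) :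
    'M[R]_(m, n) :=
  \matrix_(i, j) RLderive t0 alpha (fun s => F s i j) t.

Fixpoint PB_term n (alpha : R) (A : R -> 'M[R]_n) (t0 : R) (k : nat) :
    R -> 'M[R]_n :=
  match k with
  | 0%N => fun t => ((t - t0) `^ (alpha - 1) / Gamma alpha)%:M
  | k'.+1 => RLint_mx t0 alpha (fun s => A s *m PB_term alpha A t0 k' s)
  end.

Definition PB_partial_sum n (alpha : R) (A : R -> 'M[R]_n) (t0 : R) (N : nat)
    (t : R) : 'M[R]_n :=
  \sum_(0 <= k < N) PB_term alpha A t0 k t.

Definition state_transition n (alpha : R) (A : R -> 'M[R]_n) (t t0 : R) :
    'M[R]_n :=
  lim (PB_partial_sum alpha A t0 N t @[N --> \oo]).

Definition after (I : set R) (t0 : R) : set R := [set t | I t /\ t0 < t].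

(* If [t0] is the right end point of [I], there is no [t] in [I] beyond [t0]
   and the initial condition, a limit within [after I t0], holds vacuously;
   otherwise it is the limit [t --> t0^'+]. *)
Record RL_ivp_solution n (alpha : R) (I : set R) (t0 : R)
    (A : R -> 'M[R]_n) (x0 : 'cV[R]_n) (x : R -> 'cV[R]_n) : Prop := {
  RL_ivp_int_exists : forall t, after I t0 t -> forall i,
    RLint_exists t0 (1 - alpha) (fun s => x s i 0) t ;
  RL_ivp_derivable : forall t, I° t -> t0 < t -> forall i,
    derivable (RLint t0 (1 - alpha) (fun s => x s i 0)) t 1 ;
  RL_ivp_equation : forall t, I° t -> t0 < t ->
    RLderive_mx t0 alpha x t = A t *m x t ;
  RL_ivp_initial :
    RLint_mx t0 (1 - alpha) x t @[t --> within (after I t0) (nbhs t0)] --> x0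
}.

End FractionalCalculus.

(* Main.v *)
Require Import Defs.
From HB Require Import structures.
From mathcomp Require Import all_boot all_order all_algebra.
From mathcomp Require Import all_classical all_reals all_analysis.
From mathcomp Require Import measurable_realfun lebesgue_integral_under.
From mathcomp Require Import ring lra.

(** Write g(t) = (t - t0)^(alpha-1) / Gamma(alpha) for the first term of the
    Peano-Baker series and J^beta for the fractional integral from t0.
    Applying J^alpha(A . _) to a partial sum shifts its index, so
      S_(N+1) = g Id + J^alpha (A S_N)     ([PB_partial_sumS]),
    and, the convergence being uniform, one may pass to the limit under the
    integral sign: Phi = g Id + J^alpha (A Phi)  ([Volterra_equation]).
    Applying J^(1-alpha) to x = Phi x0, and using
      J^(1-alpha) g = 1                    ([RLint_fundamental]),
      J^(1-alpha) J^alpha f = int f        ([RLint_semigroup]),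
    gives J^(1-alpha) x (t) = x0 + int_t0^t A x  ([RLint_solution]).
    Differentiating this identity is the differential equation, and letting
    t tend to t0 is the initial condition.

    The functions met along the way may be unbounded at t0, but all of them
    belong to one class that makes the manipulations legitimate: the functions
    that are continuous on ]t0, T[ and O((s - t0)^(alpha-1)) there ([wsing_by],
    [wsing]).  It contains g, is stable under sums, under products with
    bounded continuous functions, under uniform limits ([wsing_limit]) and
    under J^beta for 0 < beta <= 1 ([wsing_by_RLint]); its members are
    integrable against the kernel of J^beta, and their primitives are
    O((t - t0)^alpha).  The continuity of J^beta f, which is what allows the
    fundamental theorem of calculus to be applied at every interior point
    rather than almost everywhere, is seen after rescaling the moving interval
    ]t0, t[ to ]0, 1[.

    The special functions enter only through the identity
      int_u^t (t - s)^(a-1) (s - u)^(b-1) ds = B(a, b) (t - u)^(a+b-1)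
    ([tpow_convolution]) and through
    Gamma(1 - alpha) Gamma(alpha) = B(1 - alpha, alpha)
    ([Gamma_onem_beta]), which makes the normalising constants in the two
    identities for J^(1-alpha) cancel. *)

Set Implicit Arguments.
Unset Strict Implicit.
Unset Printing Implicit Defensive.

Import Order.TTheory GRing.Theory Num.Theory.
Import numFieldNormedType.Exports.

Local Open Scope classical_set_scope.
Local Open Scope ring_scope.

(** * Affine change of variables in Lebesgue integrals *)

Section AffineSubstitution.
Local Open Scope ereal_scope.
Context {R : realType}.
Notation mu := (@lebesgue_measure R).

Definition affine (c d : R) : measurableTypeR R -> measurableTypeR R :=
  fun x => (c * x + d)%R.

Lemma measurable_affine c d : measurable_fun setT (affine c d).
Proof.
apply: measurable_funD; last exact: measurable_cst.
by apply: measurable_funM => //; exact: measurable_cst.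
Qed.

(* The measure structure of a pushforward takes the measurability of the map
   as an argument, which unification cannot infer; hence the explicit
   instance. *)
Let affine_image (c d : R) : {measure set (measurableTypeR R) -> \bar R} :=
  mscale (NngNum (normr_ge0 c))
    (measure_function_pushforward__canonical__measure_function_Measure
       mu (measurable_affine c d)).

(* Both measures give the same mass to every interval ]a, b]; the orientation
   of the preimage depends on the sign of c. *)
Let lebesgue_measure_affine (c d : R) : c != 0%R ->
  forall A, measurable A -> mu A = affine_image c d A.
Proof.
move=> c0; apply: lebesgue_measure_unique => _ [[a b] _ <-].
rewrite (_ : affine_image c d _ = `|c|%:E * mu (affine c d @^-1` `]a, b]))//.
rewrite lebesgue_measure_itv/= lte_fin.
case: (ltgtP c 0%R) c0 => // c0 _.
- have -> : affine c d @^-1` `]a, b] = `[((b - d) / c)%R, ((a - d) / c)%R[%classic.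
    apply/seteqP; split => x /=; rewrite !in_itv/= /affine
      ler_ndivrMr// ltr_ndivlMr// lerBrDr ltrBlDr mulrC;
      by move=> /andP[-> ->].
  rewrite lebesgue_measure_itv/= lte_fin ltr_ndivrMr// divfK ?lt_eqF// ltrD2r.
  case: ifP => _; last by rewrite mule0.
  rewrite -!EFinB -EFinM ltr0_norm//; congr _%:E.
  by field; rewrite lt_eqF.
- have -> : affine c d @^-1` `]a, b] = `]((a - d) / c)%R, ((b - d) / c)%R]%classic.
    apply/seteqP; split => x /=; rewrite !in_itv/= /affine
      ler_pdivlMr// ltr_pdivrMr// lerBrDr ltrBlDr mulrC;
      by move=> /andP[-> ->].
  rewrite lebesgue_measure_itv/= lte_fin ltr_pdivrMr// divfK ?gt_eqF// ltrD2r.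
  case: ifP => _; last by rewrite mule0.
  rewrite -!EFinB -EFinM gtr0_norm//; congr _%:E.
  by field; rewrite gt_eqF.
Qed.

Lemma ge0_integral_affine (c d : R) (f : R -> \bar R) : c != 0%R ->
  measurable_fun setT f -> (forall x, 0 <= f x) ->
  \int[mu]_x f x = `|c|%:E * \int[mu]_x f (c * x + d)%R.
Proof.
move=> c0 mf f0; transitivity (\int[affine_image c d]_x f x).
  by apply: eq_measure_integral => A mA _; exact: lebesgue_measure_affine.
rewrite ge0_integral_mscale//=.
by rewrite ge0_integral_pushforward//; exact: measurable_affine.
Qed.

End AffineSubstitution.
Arguments ge0_integral_affine {R} c d {f}.

(** * Truncated powers *)

Section TruncatedPower.
Context {R : realType}.
Implicit Types a b c x y : R.
Notation mu := (@lebesgue_measure R).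

(** The kernel x_+^(a-1).  Truncating it at 0 lets every integral below be
    taken over the whole line, so that the triangle t0 < u < s < t never has
    to appear as a domain of integration. *)
Definition tpow a x : R := if 0 < x then x `^ (a - 1) else 0.

Lemma tpowE a x : 0 < x -> tpow a x = x `^ (a - 1).
Proof. by rewrite /tpow => ->. Qed.

Lemma tpow_le0 a x : x <= 0 -> tpow a x = 0.
Proof. by rewrite /tpow ltNge => ->. Qed.

Lemma tpow_ge0 a x : 0 <= tpow a x.
Proof. by rewrite /tpow; case: ifP => // _; exact: powR_ge0. Qed.

Lemma tpow1 x : 0 < x -> tpow 1 x = 1.
Proof. by move=> x0; rewrite tpowE// subrr powRr0. Qed.

Lemma tpowM a c x : 0 < c -> tpow a (c * x) = c `^ (a - 1) * tpow a x.
Proof.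
move=> c0; rewrite /tpow pmulr_rgt0//; case: ifPn => [x0|_]; last by rewrite mulr0.
by rewrite powRM// ltW.
Qed.

Lemma tpow_anti a x y : a <= 1 -> 0 < x -> x <= y -> tpow a y <= tpow a x.
Proof.
move=> a1 x0 xy; have y0 := lt_le_trans x0 xy; rewrite !tpowE//.
rewrite -(opprB 1 a) !powRN lef_pV2 ?posrE ?powR_gt0//.
by apply: ge0_ler_powR; rewrite ?nnegrE ?subr_ge0// ltW.
Qed.

Lemma measurable_tpow a : measurable_fun setT (tpow a).
Proof.
rewrite /tpow; apply: measurable_fun_ifT.
- exact: measurable_fun_ltr.
- exact: measurable_powR.
- exact: measurable_cst.
Qed.

Lemma powR_continuous b x : 0 < x -> {for x, continuous (fun x : R => x `^ b)}.
Proof.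
move=> x0; apply: differentiable_continuous; apply/derivable1_diffP.
by case: (is_derive1_powR b x0).
Qed.

(** By monotone convergence along [1/n, 1], where the primitive x^a / a bounds
    every integral by 1/a. *)
Lemma integral_tpow_lty a : 0 < a ->
  (\int[mu]_(x in `]0%R, 1%R]) (tpow a x)%:E < +oo)%E.
Proof.
move=> a0.
pose F (n : nat) : set R := `[n.+1%:R^-1, 1]%classic.
have -> : `]0%R, 1%R]%classic = \bigcup_n F n.
  apply/seteqP; split => x /=.
    rewrite in_itv/= => /andP[x0 x1].
    exists (Num.truncn x^-1) => //; rewrite /F/= in_itv/= x1 andbT.
    by rewrite invf_ple ?posrE// ltW// truncnS_gt.
  move=> [n _]; rewrite /F/= !in_itv/= => /andP[nx ->].
  by rewrite andbT (lt_le_trans _ nx).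
have mF i : measurable (F i) by exact: measurable_itv.
have mf i : measurable_fun (F i) (EFin \o tpow a).
  by apply: measurable_funTS; apply/measurable_EFinP; exact: measurable_tpow.
have ndF : nondecreasing_seq F.
  move=> m n mn; apply/subsetPset => x; rewrite /F/= !in_itv/= => /andP[mx ->].
  by rewrite andbT (le_trans _ mx)// lef_pV2 ?posrE// ler_nat.
have cvgF : (\int[mu]_(x in F n) (tpow a x)%:E @[n --> \oo] -->
    \int[mu]_(x in \bigcup_n F n) (tpow a x)%:E)%E.
  apply: ge0_nondecreasing_set_cvg_integral => // i x _.
  by rewrite lee_fin tpow_ge0.
apply: (@le_lt_trans _ _ (a^-1)%:E); last exact: ltry.
rewrite -(cvg_lim _ cvgF)//; apply: lime_le.
  by apply/cvg_ex; eexists; exact: cvgF.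
(* The first interval is the single point 1. *)
apply: nearW => -[|n].
  by rewrite /F invr1 set_itv1 integral_set1 lee_fin invr_ge0 ltW.
have n1 : n.+2%:R^-1 < 1 :> R by rewrite invf_lt1 ?ltr1n.
have n0 : 0 < n.+2%:R^-1 :> R by [].
have pos (x : R) : n.+2%:R^-1 <= x -> 0 < x by exact: lt_le_trans.
pose G x := a^-1 * x `^ a.
have dG x : 0 < x -> is_derive x 1 G (x `^ (a - 1)).
  move=> x0; have := is_derive1_powR a x0 => dp.
  have -> : x `^ (a - 1) = a^-1 *: (a * x `^ (a - 1)).
    by rewrite /GRing.scale/= mulKf// gt_eqF.
  exact: is_deriveZ.
have cG x : 0 < x -> {for x, continuous G}.
  by move=> x0; apply: differentiable_continuous; apply/derivable1_diffP; case: (dG x x0).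
have cf x : 0 < x -> {for x, continuous (tpow a)}.
  move=> x0.
  have cp : {for x, continuous (fun x => x `^ (a - 1))}.
    exact: powR_continuous.
  rewrite /prop_for/continuous_at tpowE//; apply: cvg_trans cp.
  by apply: near_eq_cvg; near=> y; rewrite tpowE//; near: y; exact: lt_nbhsr.
rewrite (@continuous_FTC2 _ (tpow a) G)//.
- rewrite -EFinB lee_fin /G powR1 mulr1 gerBl mulr_ge0 ?powR_ge0//.
  by rewrite invr_ge0 ltW.
- apply: continuous_in_subspaceT => x /set_mem/=.
  by rewrite in_itv/= => /andP[nx _]; apply: cf; exact: pos.
- split; [|exact/cvg_at_right_filter/cG|exact/cvg_at_left_filter/cG].
  by move=> x; rewrite in_itv/= => /andP[nx _]; case: (dG x (lt_trans n0 nx)).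
- move=> x; rewrite in_itv/= => /andP[nx _]; have x0 := lt_trans n0 nx.
  by rewrite tpowE// derive1E; case: (dG x x0).
Unshelve. all: end_near. Qed.

End TruncatedPower.

(** * Beta and Gamma integrals *)

Section BetaGamma.
Context {R : realType}.
Implicit Types a b c x y : R.
Notation mu := (@lebesgue_measure R).

(** Extended-valued, so that it can be manipulated by Tonelli's theorem before
    it is known to be finite; likewise for the Gamma integral below. *)
Definition ebeta a b : \bar R := (\int[mu]_x (tpow a (1 - x) * tpow b x)%:E)%E.

Definition beta a b : R := fine (ebeta a b).

Lemma measurable_tpow_comp d (T : measurableType d) a (f : T -> R) :
  measurable_fun setT f -> measurable_fun setT (tpow a \o f).
Proof. by move=> mf; apply: measurableT_comp => //; exact: measurable_tpow. Qed.

Lemma measurable_beta_integrand a b (t u : R) :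
  measurable_fun setT (fun s : R => tpow a (t - s) * tpow b (s - u)).
Proof.
apply: measurable_funM; apply: measurable_tpow_comp.
- by apply: measurable_funB => //; exact: measurable_cst.
- by apply: measurable_funB => //; exact: measurable_cst.
Qed.

Lemma ebeta_ge0 a b : (0 <= ebeta a b)%E.
Proof. by apply: integral_ge0 => x _; rewrite lee_fin mulr_ge0 ?tpow_ge0. Qed.

(** Exponents at most 1 make the powers decreasing: on each half of ]0, 1[ the
    factor that is not singular there is at most (1/2)^(c-1) <= 2. *)
Lemma ebeta_fin_num a b : 0 < a <= 1 -> 0 < b <= 1 -> ebeta a b \is a fin_num.
Proof.
move=> /andP[a0 a1] /andP[b0 b1]; rewrite ge0_fin_numE ?ebeta_ge0//.
pose q a x := ((EFin \o tpow a) \_ `]0, 1]) x.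
have q0 c x : (0 <= q c x)%E.
  by rewrite /q patchE; case: ifP => // _; rewrite lee_fin tpow_ge0.
have mq c : measurable_fun setT (q c).
  apply/(measurable_restrictT _ _).1 => //; apply: measurable_funTS.
  by apply/measurable_EFinP; exact: measurable_tpow.
have qfin c : 0 < c -> (\int[mu]_x q c x < +oo)%E.
  by move=> c0; rewrite -integral_mkcond; exact: integral_tpow_lty.
have mq' c : measurable_fun setT (fun x => q c (1 - x)).
  apply: measurableT_comp => //.
  by apply: measurable_funB => //; exact: measurable_cst.
have qfin' c : 0 < c -> (\int[mu]_x q c (1 - x)%R < +oo)%E.
  move=> c0; have := qfin c c0.
  rewrite (ge0_integral_affine (-1) 1)// ?oppr_eq0 ?oner_eq0//.
  rewrite normrN1 mul1e.
  by under eq_integral do rewrite mulN1r addrC.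
apply: (@le_lt_trans _ _
    (2%:E * (\int[mu]_x q b x + \int[mu]_x q a (1 - x)%R))%E); last first.
  by rewrite lte_mul_pinfty// lte_add_pinfty// (qfin, qfin').
have <- : (\int[mu]_x (2%:E * (q b x + q a (1 - x)%R)) =
    2%:E * (\int[mu]_x q b x + \int[mu]_x q a (1 - x)%R))%E.
  rewrite ge0_integralZl ?ge0_integralD//.
  - exact: mq.
  - exact: mq'.
  - by apply: emeasurable_funD; [exact: mq|exact: mq'].
  - by move=> x _; rewrite adde_ge0.
apply: ge0_le_integral => //.
- by move=> x _; rewrite lee_fin mulr_ge0 ?tpow_ge0.
- apply/measurable_EFinP; have := measurable_beta_integrand a b 1 0.
  by under eq_fun do rewrite subr0.
- apply: measurable_funeM.
  by apply: emeasurable_funD; [exact: mq|exact: mq'].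
move=> x _; have [x0|x0] := leP x 0.
  by rewrite (tpow_le0 _ x0) mulr0 mule_ge0// adde_ge0.
have [x1|x1] := leP 1 x.
  by rewrite [tpow a _]tpow_le0 ?subr_le0// mul0r mule_ge0// adde_ge0.
have qE c y : 0 < y -> y < 1 -> q c y = (tpow c y)%:E.
  by move=> y0 y1; rewrite /q patchE ifT// inE/= in_itv/= y0 ltW.
rewrite !qE ?subr_gt0//; last by rewrite gtrBl.
(* The factor that stays away from its singularity. *)
have half c y : 0 < c -> c <= 1 -> 2^-1 <= y -> tpow c y <= 2.
  move=> c0 c1 hy; have h0 : 0 < 2^-1 :> R by rewrite invr_gt0.
  rewrite (le_trans (tpow_anti _ h0 hy))// tpowE//.
  rewrite -powR_inv1// -powRrM mulN1r opprB.
  by rewrite -[leRHS]powRr1//; apply: ler_powR; rewrite ?ler1n// gerBl ltW.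
rewrite -EFinD -EFinM lee_fin mulrDr.
have [xh|xh] := leP 2^-1 x.
- apply: (@le_trans _ _ (2 * tpow a (1 - x))).
    by rewrite [leRHS]mulrC ler_wpM2l ?tpow_ge0// half.
  by rewrite lerDr mulr_ge0// tpow_ge0.
- apply: (@le_trans _ _ (2 * tpow b x)).
    by rewrite ler_wpM2r ?tpow_ge0// half//; lra.
  by rewrite lerDl mulr_ge0// tpow_ge0.
Qed.

Lemma betaE a b : 0 < a <= 1 -> 0 < b <= 1 -> (beta a b)%:E = ebeta a b.
Proof. by move=> ha hb; rewrite fineK// ebeta_fin_num. Qed.

(** The substitution s = u + (t - u) x carries the integral to ]0, 1[.  With
    truncated powers the case t <= u is covered too, both sides being 0. *)
Lemma tpow_convolution a b (t u : R) : 0 < a <= 1 -> 0 < b <= 1 ->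
  (\int[mu]_s (tpow a (t - s) * tpow b (s - u))%:E)%E =
  (tpow (a + b) (t - u) * beta a b)%:E.
Proof.
move=> ha hb; have [tu|ut] := leP (t - u) 0.
  rewrite tpow_le0// mul0r; apply: integral0_eq => s _.
  have [su|us] := leP (s - u) 0; first by rewrite (tpow_le0 _ su) mulr0.
  by rewrite [tpow a _]tpow_le0 ?mul0r//; lra.
rewrite (ge0_integral_affine (t - u) u) ?gt_eqF//; last 2 first.
- by apply/measurable_EFinP; exact: measurable_beta_integrand.
- by move=> x; rewrite lee_fin mulr_ge0// tpow_ge0.
transitivity (\int[mu]_x (((t - u) `^ (a - 1) * (t - u) `^ (b - 1))%:E *
    (tpow a (1 - x) * tpow b x)%:E) * `|t - u|%:E)%E.
  rewrite muleC; congr (_ * _)%E; apply: eq_integral => x _.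
  rewrite -EFinM; congr _%:E.
  have -> : t - ((t - u) * x + u) = (t - u) * (1 - x) by ring.
  have -> : (t - u) * x + u - u = (t - u) * x by ring.
  by rewrite !tpowM// mulrACA.
rewrite ge0_integralZl//; last 3 first.
- apply/measurable_EFinP; have := measurable_beta_integrand a b 1 0.
  by under eq_fun do rewrite subr0.
- by move=> x _; rewrite lee_fin mulr_ge0// tpow_ge0.
- by rewrite lee_fin mulr_ge0// powR_ge0.
rewrite -/(ebeta a b) -betaE// -!EFinM; congr _%:E.
rewrite gtr0_norm// mulrAC; congr (_ * _).
rewrite tpowE// -powRD; last by rewrite (gt_eqF ut) implybT.
by rewrite mulrC -{1}(powRr1 (ltW ut)) -powRD ?(gt_eqF ut) ?implybT//; congr (_ `^ _); lra.
Qed.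

Definition egamma a : \bar R := (\int[mu]_x (tpow a x * expR (- x))%:E)%E.

Lemma measurable_egamma_integrand a :
  measurable_fun setT (fun x => tpow a x * expR (- x)).
Proof.
apply: measurable_funM; first exact: measurable_tpow.
by apply: measurableT_comp => //; exact: measurable_expR.
Qed.

(** Write the product as a double integral, translate the second variable by
    the first, and exchange: the inner integral becomes a convolution of
    truncated powers. *)
Lemma egammaM a b : 0 < a <= 1 -> 0 < b <= 1 ->
  (egamma b * egamma a)%E = ((beta a b)%:E * egamma (a + b))%E.
Proof.
move=> ha hb.
have m1 : measurable_fun setT
    (fun p : R * R => (tpow b p.1 * tpow a (p.2 - p.1) * expR (- p.2))%:E).
  apply/measurable_EFinP; apply: measurable_funM.
    apply: measurable_funM; first exact: measurable_tpow_comp.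
    by apply: measurable_tpow_comp; exact: measurable_funB.
  apply: measurableT_comp; first exact: measurable_expR.
  exact: measurableT_comp.
have g0 c x : (0 <= (tpow c x * expR (- x))%:E)%E.
  by rewrite lee_fin mulr_ge0// ?tpow_ge0 ?expR_ge0.
transitivity (\int[mu]_x \int[mu]_y
    (tpow b x * tpow a (y - x) * expR (- y))%:E)%E.
  rewrite muleC -ge0_integralZl//; last 2 first.
  - by apply/measurable_EFinP; exact: measurable_egamma_integrand.
  - exact: integral_ge0.
  apply: eq_integral => x _; rewrite muleC.
  rewrite /egamma (ge0_integral_affine 1 (- x)) ?oner_eq0//; last first.
    by apply/measurable_EFinP; exact: measurable_egamma_integrand.
  rewrite normr1 mul1e -ge0_integralZl//; last first.
    apply/measurable_EFinP.
    exact: (measurableT_comp (measurable_egamma_integrand a)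
      (measurable_affine 1 (- x))).
  apply: eq_integral => y _; rewrite -EFinM; congr _%:E.
  rewrite mul1r mulrACA -expRD; congr (_ * expR _); ring.
transitivity (\int[mu]_y \int[mu]_x
    (tpow b x * tpow a (y - x) * expR (- y))%:E)%E.
  refine (@fubini_tonelli _ _ _ _ R mu mu _ m1 _).
  by move=> p; rewrite lee_fin !mulr_ge0// ?tpow_ge0 ?expR_ge0.
rewrite /egamma -ge0_integralZl//; last 2 first.
- by apply/measurable_EFinP; exact: measurable_egamma_integrand.
- by rewrite betaE// ebeta_ge0.
apply: eq_integral => y _.
rewrite -EFinM mulrA [beta a b * _]mulrC [RHS]EFinM.
have -> : (tpow (a + b) y * beta a b)%:E =
    (\int[mu]_s (tpow a (y - s) * tpow b (s - 0))%:E)%E.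
  by rewrite tpow_convolution// subr0.
rewrite muleC -ge0_integralZl//; last 2 first.
- by apply/measurable_EFinP; exact: measurable_beta_integrand.
- by move=> x _; rewrite lee_fin mulr_ge0// tpow_ge0.
by apply: eq_integral => x _; rewrite -EFinM subr0; congr _%:E; ring.
Qed.

Lemma egammaE a :
  egamma a = (\int[mu]_(x in `]0%R, +oo[) (x `^ (a - 1) * expR (- x))%:E)%E.
Proof.
rewrite integral_mkcond; apply: eq_integral => x _; rewrite patchE mem_setE.
rewrite in_itv/= andbT; case: ifPn => [x0|]; first by rewrite tpowE.
by rewrite -leNgt => x0; rewrite tpow_le0// mul0r.
Qed.

Lemma egamma1 : egamma 1 = 1%E.
Proof.
rewrite egammaE -(@integral_exponential_pdf R 1)//.
transitivity (\int[mu]_(x in `[0%R, +oo[) (expR (- x))%:E)%E; last first.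
  rewrite integral_mkcond; apply: eq_integral => x _.
  by rewrite /exponential_pdf !patchE; case: ifP; rewrite ?mul1r ?mulN1r.
rewrite -[RHS]integral_itv_obnd_cbnd//.
  by apply: eq_integral => x _; rewrite subrr powRr0 mul1r.
apply/measurable_EFinP/measurable_funTS.
by apply: measurableT_comp => //; exact: measurable_expR.
Qed.

(** On ]0, 1] the integrand is at least exp(-1). *)
Lemma egamma_gt0 a : a <= 1 -> (0 < egamma a)%E.
Proof.
move=> a1; apply: (@lt_le_trans _ _ (expR (-1))%:E); first by rewrite lte_fin expR_gt0.
apply: (@le_trans _ _ (\int[mu]_(x in `]0%R, 1%R]) (expR (-1))%:E)%E).
  by rewrite integral_cst//= lebesgue_measure_itv/= lte_fin ltr01 sube0 mule1.
rewrite integral_mkcond; apply: ge0_le_integral => //.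
- by move=> x _; rewrite patchE; case: ifP => // _; rewrite lee_fin expR_ge0.
- by apply/(measurable_restrictT _ _).1 => //; exact: measurable_cst.
- by apply/measurable_EFinP; exact: measurable_egamma_integrand.
move=> x _; rewrite patchE mem_setE in_itv/=; case: ifPn => [/andP[x0 x1]|_].
  rewrite lee_fin -[leLHS]mul1r ler_pM ?expR_ge0// ?ler_expR ?lerN2//.
  by rewrite -(tpow1 (@ltr01 R)) (le_trans _ (tpow_anti a1 x0 x1))// !tpowE// !powR1.
by rewrite lee_fin mulr_ge0 ?tpow_ge0 ?expR_ge0.
Qed.

(** The case a + b = 1 of the product formula.  Finiteness of the Gamma
    integral is a by-product: a product of two positive extended reals is
    finite only if both factors are. *)
Lemma Gamma_onem_beta a : 0 < a < 1 ->
  [/\ 0 < Gamma a, 0 < Gamma (1 - a) &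
    Gamma (1 - a) * Gamma a = beta (1 - a) a].
Proof.
move=> /andP[a0 a1].
have ha : 0 < a <= 1 by rewrite a0 ltW.
have hb : 0 < 1 - a <= 1 by rewrite subr_gt0 a1 gerBl ltW.
have GE c : Gamma c = fine (egamma c) by rewrite egammaE.
have ga : (0 < egamma a)%E by rewrite egamma_gt0// ltW.
have gb : (0 < egamma (1 - a))%E by rewrite egamma_gt0// gerBl ltW.
have := egammaM hb ha; rewrite subrK egamma1 mule1 !GE.
move: ga gb; case: (egamma a) => [x| |]//; case: (egamma (1 - a)) => [y| |]//=.
- by rewrite !lte_fin => x0 y0 [<-]; split => //; rewrite mulrC.
- by rewrite lte_fin => x0 _; rewrite mulry gtr0_sg// mul1e.
- by rewrite lte_fin => _ y0; rewrite mulyr gtr0_sg// mul1e.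
Qed.

End BetaGamma.

(** * Weakly singular functions and their fractional integrals *)

Section WeaklySingular.
Context {R : realType}.
Implicit Types (a b c t u C : R) (f : R -> R).
Notation mu := (@lebesgue_measure R).

(** The constant C is explicit because limits are controlled by letting it
    tend to 0. *)
Definition wsing_by t0 T a C f :=
  (forall s, t0 < s < T -> {for s, continuous f}) /\
  (forall s, t0 < s < T -> `|f s| <= C * tpow a (s - t0)).

Lemma integrable_beta a b t u : 0 < a <= 1 -> 0 < b <= 1 ->
  mu.-integrable setT (EFin \o (fun s : R => tpow b (t - s) * tpow a (s - u))).
Proof.
move=> ha hb; apply/integrableP; split.
  by apply/measurable_EFinP; exact: measurable_beta_integrand.
under eq_integral.
  move=> x _ /=; rewrite ger0_norm ?mulr_ge0 ?tpow_ge0//; over.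
by rewrite tpow_convolution// ltry.
Qed.

Lemma wsing_by_measurable t0 T a C f : wsing_by t0 T a C f ->
  measurable_fun `]t0, T[ f.
Proof.
move=> [cf _]; apply: open_continuous_measurable_fun => //.
by move=> x; rewrite inE/= in_itv/=; exact: cf.
Qed.

Lemma wsing_by_sub t0 T t a C f : t <= T -> wsing_by t0 T a C f ->
  wsing_by t0 t a C f.
Proof.
by move=> tT [cf bf]; split => s /andP[s0 st]; [apply: cf|apply: bf];
  rewrite s0 (lt_le_trans st).
Qed.

Lemma measurable_RL_kernel t0 t b f : measurable_fun `]t0, t[ f ->
  measurable_fun `]t0, t[ (RL_kernel b f t).
Proof.
move=> mf; apply: measurable_funM => //; apply: measurable_funTS.
apply: (measurableT_comp (measurable_powR (b - 1))).
by apply: measurable_funB => //; exact: measurable_cst.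
Qed.

Lemma RL_kernel_bound t0 t a b C f s : wsing_by t0 t a C f -> t0 < s < t ->
  `|RL_kernel b f t s| <= C * (tpow b (t - s) * tpow a (s - t0)).
Proof.
move=> [_ bf] /[dup] hs /andP[s0 st]; rewrite /RL_kernel normrM.
rewrite ger0_norm ?powR_ge0// -tpowE ?subr_gt0// mulrCA.
by rewrite ler_wpM2l ?tpow_ge0// bf.
Qed.

Lemma wsing_by_RLint_exists t0 t a b C f : 0 < a <= 1 -> 0 < b <= 1 ->
  wsing_by t0 t a C f -> RLint_exists t0 b f t.
Proof.
move=> ha hb wf.
apply: (@le_integrable _ _ R mu _ _ _
  (EFin \o (fun s : R => C * (tpow b (t - s) * tpow a (s - t0))))) => //.
- apply/measurable_EFinP.
  exact: (measurable_RL_kernel b (wsing_by_measurable wf)).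
- move=> s /=; rewrite in_itv/= => hs; rewrite lee_fin.
  by rewrite (le_trans (RL_kernel_bound b wf hs))// ler_norm.
- apply: (@integrableS _ _ _ mu setT) => //.
  exact: (integrableZl measurableT C (integrable_beta t t0 ha hb)).
Qed.

(** Dominate by C times the convolution of truncated powers over the whole
    line. *)
Lemma Rintegral_RL_kernel_bound t0 t a b C f :
  0 < a <= 1 -> 0 < b <= 1 -> 0 <= C -> wsing_by t0 t a C f ->
  `|\int[mu]_(s in `]t0, t[) RL_kernel b f t s| <=
  C * (tpow (b + a) (t - t0) * beta b a).
Proof.
move=> ha hb C0 wf.
have mw : measurable_fun setT
    (fun s : R => (C * (tpow b (t - s) * tpow a (s - t0)))%:E).
  apply/measurable_EFinP; apply: measurable_funM => //.
  exact: measurable_beta_integrand.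
have mf : measurable_fun `]t0, t[ (fun s => (RL_kernel b f t s)%:E).
  apply/measurable_EFinP.
  exact: (measurable_RL_kernel b (wsing_by_measurable wf)).
have w0 (s : R) : (0 <= (C * (tpow b (t - s) * tpow a (s - t0)))%:E)%E.
  by rewrite lee_fin !mulr_ge0 ?tpow_ge0.
rewrite -lee_fin EFin_normr_Rintegral//; last exact: wsing_by_RLint_exists wf.
refine (le_trans (le_abse_integral mu _ mf) _) => //.
apply: (@le_trans _ _ (\int[mu]_(s in `]t0, t[)
    (C * (tpow b (t - s) * tpow a (s - t0)))%:E)%E).
  apply: ge0_le_integral => //.
  - exact: measurableT_comp.
  - exact: measurable_funTS mw.
  - move=> s; rewrite /= in_itv/= => hs; rewrite lee_fin.
    exact: RL_kernel_bound wf hs.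
apply: (@le_trans _ _ (\int[mu]_s
    (C * (tpow b (t - s) * tpow a (s - t0)))%:E)%E).
  exact: ge0_subset_integral.
under eq_integral do rewrite EFinM.
rewrite ge0_integralZl//.
- by rewrite tpow_convolution.
- by apply/measurable_EFinP; exact: measurable_beta_integrand.
- by move=> x _; rewrite lee_fin mulr_ge0// tpow_ge0.
Qed.

Lemma RLint_bound t0 t a b C f : 0 < a <= 1 -> 0 < b <= 1 -> 0 <= C ->
  wsing_by t0 t a C f ->
  `|RLint t0 b f t| <=
  `|(Gamma b)^-1| * (C * (tpow (b + a) (t - t0) * beta b a)).
Proof.
move=> ha hb C0 wf; rewrite /RLint normrM ler_wpM2l//.
exact: Rintegral_RL_kernel_bound.
Qed.

End WeaklySingular.

(** * Continuity of fractional integrals *)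

Section RLcontinuity.
Context {R : realType}.
Implicit Types (a b c t u C : R) (f : R -> R).
Notation mu := (@lebesgue_measure R).

(** Apply the nonnegative case to the positive and the negative parts. *)
Lemma Rintegral_affine (c d : R) (f : R -> R) : c != 0 ->
  mu.-integrable setT (EFin \o f) ->
  \int[mu]_x f x = `|c| * \int[mu]_x f (c * x + d).
Proof.
move=> c0 intf; have mf : measurable_fun setT (EFin \o f).
  exact: measurable_int intf.
have fp : (\int[mu]_x ((EFin \o f)^\+ x) =
    `|c|%:E * \int[mu]_x ((EFin \o f)^\+ (c * x + d)%R))%E.
  by rewrite (ge0_integral_affine c d)//; exact: measurable_funepos.
have fn : (\int[mu]_x ((EFin \o f)^\- x) =
    `|c|%:E * \int[mu]_x ((EFin \o f)^\- (c * x + d)%R))%E.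
  by rewrite (ge0_integral_affine c d)//; exact: measurable_funeneg.
have c1 : (0 < `|c|%:E)%E by rewrite lte_fin normr_gt0.
have finp := integrable_fin_num measurableT (integrable_funepos measurableT intf).
have finn := integrable_fin_num measurableT (integrable_funeneg measurableT intf).
(* The integrals after substitution are finite because c is nonzero. *)
have lem (x : \bar R) : (`|c|%:E * x)%E \is a fin_num -> x \is a fin_num.
  by case: x => //; rewrite ?gt0_mulye ?gt0_muley ?gt0_muleNy.
rewrite /Rintegral integralE fp fn [in RHS]integralE.
rewrite fp in finp; rewrite fn in finn.
have fp' := lem _ finp; have fn' := lem _ finn.
rewrite -muleBr ?fin_num_adde_defl ?fin_numN//.
rewrite fineM; [|by []|by rewrite fin_numB fp' fn'].
by congr (_ * fine (_ - _)); apply: eq_integral => x _; rewrite ?funeposE ?funenegE.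
Qed.

Lemma wsing_by_scale t0 t a C f : t0 < t -> wsing_by t0 t a C f ->
  wsing_by 0 1 a (C * (t - t0) `^ (a - 1)) (fun r => f ((t - t0) * r + t0)).
Proof.
move=> t0t [cf bf]; have c0 : 0 < t - t0 by rewrite subr_gt0.
have itv r : 0 < r < 1 -> t0 < (t - t0) * r + t0 < t.
  move=> /andP[r0 r1].
  by rewrite ltrDr mulr_gt0//= -ltrBrDr gtr_pMr.
split=> r /itv hr; last first.
  by rewrite (le_trans (bf _ hr))// addrK tpowM// subr0 mulrA.
apply: (@continuous_comp _ _ _ (fun r => (t - t0) * r + t0) f); last exact: cf.
by apply: cvgD; [apply: cvgMl_tmp; exact: cvg_id|exact: cvg_cst].
Qed.

(** Moves the dependence on the endpoint t from the singular kernel and the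
    domain of integration into the argument of the continuous function f. *)
Lemma RLint_scale t0 t a b C f : t0 < t -> 0 < a <= 1 -> 0 < b <= 1 ->
  wsing_by t0 t a C f ->
  RLint t0 b f t =
  (t - t0) `^ b * RLint 0 b (fun r => f ((t - t0) * r + t0)) 1.
Proof.
move=> t0t ha hb wf; rewrite /RLint mulrCA; congr (_ * _).
have c0 : 0 < t - t0 by rewrite subr_gt0.
rewrite Rintegral_mkcond (@Rintegral_affine (t - t0) t0) ?gt_eqF//; last first.
  rewrite -restrict_EFin; apply/(integrable_restrict _ _) => //.
  by rewrite setTI; exact: wsing_by_RLint_exists wf.
rewrite gtr0_norm//.
have -> : (fun x : R => (RL_kernel b f t \_ `]t0, t[) ((t - t0) * x + t0)) =
  (fun r : R => (t - t0) `^ (b - 1) *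
     RL_kernel b (fun r => f ((t - t0) * r + t0)) 1 r) \_ `]0, 1[.
  apply/funext => x; rewrite !patchE !mem_setE !in_itv/=.
  rewrite ltrDr pmulr_rgt0// -ltrBrDr gtr_pMr//.
  case: ifPn => // /andP[x0 x1]; rewrite /RL_kernel mulrA; congr (_ * _).
  have -> : t - ((t - t0) * x + t0) = (t - t0) * (1 - x) by ring.
  by rewrite powRM// ?subr_ge0 ltW.
rewrite -Rintegral_mkcond RintegralZl//.
  by rewrite mulrA mulr_powRB1// ?ltW//; case/andP: hb.
exact: (wsing_by_RLint_exists ha hb (wsing_by_scale t0t wf)).
Qed.

(** After rescaling, the integrand depends continuously on t and is dominated,
    for t beyond u > t0, by a multiple of (1 - r)^(b-1) r^(a-1). *)
Lemma RLint_continuous t0 T a b C f : 0 < a <= 1 -> 0 < b <= 1 -> 0 <= C ->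
  wsing_by t0 T a C f ->
  forall t, t0 < t < T -> {for t, continuous (RLint t0 b f)}.
Proof.
move=> ha hb C0 wf t /andP[t0t tT].
(* Staying above u keeps (x - t0)^(a-1) bounded as x varies. *)
pose u := (t0 + t) / 2.
have t0u : t0 < u by rewrite /u midf_lt.
have ut : u < t by rewrite /u midf_lt.
pose F (x r : R) := RL_kernel b (fun r => f ((x - t0) * r + t0)) 1 r.
have wx x : u < x < T -> wsing_by t0 x a C f.
  by move=> /andP[ux xT]; exact: wsing_by_sub (ltW xT) wf.
have cint : {in `]u, T[%classic,
    continuous (fun x => \int[mu]_(r in `]0%R, 1%R[) F x r)}.
  apply: (@continuity_under_integral _ _ _ mu F _ _ u T _ _
      (fun r : R => C * tpow a (u - t0) * (tpow b (1 - r) * tpow a (r - 0)))).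
  - by [].
  - move=> x; rewrite /= in_itv/= => ux.
    apply: (wsing_by_RLint_exists ha hb (wsing_by_scale _ (wx x ux))).
    by case/andP: ux => ux _; exact: lt_trans ux.
  - apply: aeW => r; rewrite /= in_itv/= => /andP[r0 r1] x.
    rewrite inE/= in_itv/= => /andP[ux xT].
    apply: (@cvgMl_tmp R^o); apply: (@continuous_comp _ _ _ (fun x => (x - t0) * r + t0) f).
      apply: cvgD; last exact: cvg_cst.
      by apply: cvgMr_tmp; apply: cvgB; [exact: cvg_id|exact: cvg_cst].
    case: wf => cf _; apply: cf; rewrite ltrDr mulr_gt0 ?subr_gt0 ?(lt_trans t0u)//=.
    rewrite (lt_trans _ xT)// -ltrBrDr gtr_pMr// subr_gt0; exact: lt_trans ux.
  - apply: (@integrableS _ _ _ mu setT) => //.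
    exact: (integrableZl measurableT _ (integrable_beta 1 0 ha hb)).
  - move=> x; rewrite /= in_itv/= => /[dup] ux /andP[ux1 xT].
    have t0x : t0 < x by exact: lt_trans ux1.
    apply: aeW => r; rewrite /= in_itv/= => hr.
    rewrite (le_trans (RL_kernel_bound b (wsing_by_scale t0x (wx x ux)) hr))//.
    rewrite ler_wpM2r ?mulr_ge0 ?tpow_ge0// ler_wpM2l//.
    rewrite -tpowE ?subr_gt0//; apply: tpow_anti; first by case/andP: ha.
      by rewrite subr_gt0.
    by rewrite lerB// ltW.
have {}cint : {for t, continuous (fun x => \int[mu]_(r in `]0%R, 1%R[) F x r)}.
  by apply: cint; rewrite inE/= in_itv/= ut.
have cs : {for t, continuous (fun x => (x - t0) `^ b *
    ((Gamma b)^-1 * \int[mu]_(r in `]0%R, 1%R[) F x r))}.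
  apply: cvgM; last by apply: cvgMl_tmp; exact: cint.
  apply: (@continuous_comp _ _ _ (fun x => x - t0) (fun x : R => x `^ b)).
    by apply: cvgB; [exact: cvg_id|exact: cvg_cst].
  by apply: powR_continuous; rewrite subr_gt0.
rewrite /prop_for/continuous_at (RLint_scale t0t ha hb (wsing_by_sub (ltW tT) wf)).
apply: cvg_trans cs; apply: near_eq_cvg; near=> x.
have ux : u < x < T.
  by apply/andP; split; near: x; [exact: lt_nbhsr|exact: lt_nbhsl].
by rewrite (RLint_scale _ ha hb (wx x ux))//; case/andP: ux => ux _; exact: lt_trans ux.
Unshelve. all: end_near. Qed.

(** The exponent of the singularity improves by b; on a bounded interval the
    gain (t - t0)^b is absorbed in the constant. *)
Lemma wsing_by_RLint t0 T a b C f : 0 < a <= 1 -> 0 < b <= 1 -> 0 <= C ->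
  wsing_by t0 T a C f ->
  wsing_by t0 T a (`|(Gamma b)^-1| * C * beta b a * (T - t0) `^ b)
    (RLint t0 b f).
Proof.
move=> ha hb C0 wf; split; first exact: RLint_continuous wf.
move=> t /andP[t0t tT].
rewrite (le_trans (RLint_bound ha hb C0 (wsing_by_sub (ltW tT) wf)))//.
rewrite -!mulrA ler_wpM2l// ler_wpM2l// mulrC ler_wpM2l//.
  by rewrite fine_ge0// ebeta_ge0.
rewrite tpowE ?subr_gt0// -addrA powRD; last first.
  by rewrite subr_eq0 (gt_eqF t0t) implybT.
rewrite -tpowE ?subr_gt0// ler_wpM2r ?tpow_ge0//.
case/andP: hb => /ltW b0 _; have := ltW tT; have := ltW t0t => t0t' tT'.
apply: ge0_ler_powR; rewrite ?nnegrE ?subr_ge0 ?lerB//.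
exact: le_trans tT'.
Qed.

End RLcontinuity.

(** * Composition of complementary fractional integrals *)

Section Semigroup.
Context {R : realType}.
Implicit Types (a b c t u C : R) (f g : R -> R).
Notation mu := (@lebesgue_measure R).

Lemma RL_kernel1 f t s : s < t -> RL_kernel 1 f t s = f s.
Proof. by rewrite /RL_kernel subrr powRr0 mul1r. Qed.

(** Ordinary integration is the case b = 1 of fractional integration. *)
Lemma wsing_by_integrable t0 t a C f : 0 < a <= 1 -> wsing_by t0 t a C f ->
  mu.-integrable `]t0, t[ (EFin \o f).
Proof.
move=> ha wf; have i1 : 0 < (1 : R) <= 1 by rewrite ltr01 lexx.
apply: eq_integrable (wsing_by_RLint_exists ha i1 wf) => //.
by move=> s; rewrite inE/= in_itv/= => /andP[_ st]; rewrite /= RL_kernel1.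
Qed.

Lemma Rintegral_bound t0 t a C f : 0 < a <= 1 -> 0 <= C -> t0 < t ->
  wsing_by t0 t a C f ->
  `|\int[mu]_(s in `]t0, t[) f s| <= C * beta 1 a * (t - t0) `^ a.
Proof.
move=> ha C0 t0t wf; have i1 : 0 < (1 : R) <= 1 by rewrite ltr01 lexx.
have := Rintegral_RL_kernel_bound ha i1 C0 wf.
rewrite tpowE ?subr_gt0// addrAC subrr add0r [_ * beta _ _]mulrC mulrA.
congr (`|_| <= _); apply: eq_Rintegral => s.
by rewrite inE/= in_itv/= => /andP[_ st]; rewrite RL_kernel1.
Qed.

(** Exchange the order of integration.  The integral of the two kernels over
    the intermediate variable s is B(1-a, a) (t - u)^0, a constant, which the
    two Gamma factors cancel. *)
Lemma RLint_semigroup t0 t a C f : 0 < a < 1 -> 0 <= C -> wsing_by t0 t a C f ->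
  RLint t0 (1 - a) (RLint t0 a f) t = \int[mu]_(s in `]t0, t[) f s.
Proof.
move=> /[dup] ha1 /andP[a0 a1] C0 wf.
have ha : 0 < a <= 1 by rewrite a0 ltW.
have hb : 0 < 1 - a <= 1 by rewrite subr_gt0 a1 gerBl ltW.
have [Ga Gb GM] := Gamma_onem_beta ha1.
have Ga0 : Gamma a != 0 by rewrite (gt_eqF Ga).
have Gb0 : Gamma (1 - a) != 0 by rewrite (gt_eqF Gb).
pose fb := f \_ `]t0, t[.
have mfb : measurable_fun setT fb.
  by apply/(measurable_restrictT _ _).1 => //; exact: wsing_by_measurable wf.
have intf := wsing_by_integrable ha wf.
have intfb : mu.-integrable setT (EFin \o fb).
  by rewrite /fb -restrict_EFin; apply/(integrable_restrict _ _) => //; rewrite setTI.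
pose G (p : R * R) : \bar R := (tpow (1 - a) (t - p.1) * tpow a (p.1 - p.2) * fb p.2)%:E.
have mG : measurable_fun setT G.
  apply/measurable_EFinP; apply: measurable_funM; last exact: measurableT_comp.
  apply: measurable_funM; apply: measurable_tpow_comp.
    by apply: measurable_funB => //; exact: measurable_cst.
  exact: measurable_funB.
have fbt u : fb u != 0 -> u < t.
  by rewrite /fb patchE mem_setE in_itv/=; case: ifPn => [/andP[]//|]; rewrite eqxx.
(* Where fb does not vanish, u < t and the power (t - u)^0 is 1. *)
have key u : tpow (1 - a + a) (t - u) * beta (1 - a) a * `|fb u| =
    beta (1 - a) a * `|fb u|.
  have [->|/fbt ut] := eqVneq (fb u) 0; first by rewrite normr0 !mulr0.
  by rewrite subrK tpow1 ?subr_gt0// mul1r.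
have inner_abs u : (\int[mu]_s `|G (s, u)| = (beta (1 - a) a * `|fb u|)%:E)%E.
  transitivity (\int[mu]_s (`|fb u|%:E * (tpow (1 - a) (t - s) * tpow a (s - u))%:E))%E.
    apply: eq_integral => s _; rewrite /G/= normrM mulrC EFinM; congr (_ * _%:E)%E.
    by rewrite ger0_norm// mulr_ge0// tpow_ge0.
  rewrite ge0_integralZl//; last 2 first.
  - by apply/measurable_EFinP; exact: measurable_beta_integrand.
  - by move=> x _; rewrite lee_fin mulr_ge0// tpow_ge0.
  by rewrite tpow_convolution// -EFinM mulrC key.
have inner u : (\int[mu]_s G (s, u) = (beta (1 - a) a * fb u)%:E)%E.
  rewrite /G/=; under eq_integral do rewrite EFinM.
  rewrite (integralZr measurableT (integrable_beta t u ha hb))//.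
  rewrite tpow_convolution// -EFinM; have [->|/fbt ut] := eqVneq (fb u) 0.
    by rewrite !mulr0.
  by rewrite subrK tpow1 ?subr_gt0// mul1r.
have intG : (mu \x mu)%E.-integrable setT G.
  apply/integrable21ltyP => //; under eq_integral do rewrite inner_abs.
  under eq_integral do rewrite EFinM.
  rewrite ge0_integralZl//.
  - rewrite betaE// -ge0_fin_numE; last first.
      by rewrite mule_ge0 ?ebeta_ge0//; exact: integral_ge0.
    rewrite fin_numM// ?ebeta_fin_num//.
    exact: (integrable_fin_num measurableT (integrable_abse intfb)).
  - by apply/measurable_EFinP; exact: measurableT_comp.
  - by rewrite lee_fin fine_ge0// ebeta_ge0.
have outer s : (\int[mu]_u G (s, u) =
   (((fun s => Gamma a * RL_kernel (1 - a) (RLint t0 a f) t s) \_ `]t0, t[) s)%:E)%E.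
  rewrite patchE mem_setE in_itv/=; case: ifPn => [/andP[t0s st]|nst]; last first.
    apply: integral0_eq => u _; rewrite /G/=.
    have [ts|st] := leP t s; first by rewrite [tpow _ (t - s)]tpow_le0 ?subr_le0// !mul0r.
    have [su|us] := leP s u; first by rewrite [tpow a _]tpow_le0 ?subr_le0// mulr0 mul0r.
    rewrite /fb patchE mem_setE in_itv/= [_ < u]ltNge.
    move: nst; rewrite st andbT -leNgt => st0.
    by rewrite (ltW (lt_le_trans us st0))/= mulr0.
  have wfs := wsing_by_sub (ltW st) wf.
  transitivity (\int[mu]_(u in `]t0, s[) (tpow (1 - a) (t - s) * RL_kernel a f s u)%:E)%E.
    rewrite [RHS]integral_mkcond; apply: eq_integral => u _; rewrite /G/= /fb.
    rewrite !patchE !mem_setE !in_itv/=.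
    have [su|us] := leP s u.
      by rewrite andbF [tpow a _]tpow_le0 ?subr_le0// mulr0 mul0r.
    rewrite andbT (lt_trans us st) andbT; case: ifPn => [t0u|]; last by rewrite mulr0.
    by rewrite /RL_kernel -tpowE ?subr_gt0// mulrA.
  have intk := wsing_by_RLint_exists ha ha wfs.
  under eq_integral do rewrite EFinM.
  rewrite (integralZl _ intk)//.
  rewrite -[X in (_ * X)%E]fineK; last exact: integrable_fin_num.
  rewrite -EFinM; congr _%:E.
  by rewrite /RL_kernel /RLint -tpowE ?subr_gt0// mulrCA (mulVKf Ga0).
have := Fubini intG; under eq_integral do rewrite outer.
under [in RHS]eq_integral do rewrite inner.
move=> /(congr1 fine); rewrite -!/(Rintegral _ _ _).
rewrite -Rintegral_mkcond !RintegralZl//; last first.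
  have wJ := wsing_by_RLint ha ha C0 wf.
  exact: wsing_by_RLint_exists ha hb wJ.
rewrite /fb -Rintegral_mkcond => E.
rewrite {1}/RLint.
apply: (mulfI (mulf_neq0 Gb0 Ga0)).
by rewrite {2}GM -E mulrCA -!mulrA (mulKf Gb0).
Qed.

End Semigroup.

(** * Linearity, the first term of the series, primitives, uniform limits *)

Section Linear.
Context {R : realType}.
Implicit Types (a b c t u C : R) (f g : R -> R).
Notation mu := (@lebesgue_measure R).

Definition wsing t0 T a f := exists2 C, 0 <= C & wsing_by t0 T a C f.

Lemma RLint_ext t0 b t f g : (forall s, t0 < s < t -> f s = g s) ->
  RLint t0 b f t = RLint t0 b g t.
Proof.
move=> fg; congr (_ * _); apply: eq_Rintegral => s.
by rewrite inE/= in_itv/= /RL_kernel => /fg ->.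
Qed.

Lemma wsing_sub t0 T t a f : t <= T -> wsing t0 T a f -> wsing t0 t a f.
Proof. by move=> tT [C C0 wf]; exists C => //; exact: wsing_by_sub wf. Qed.

Lemma wsing0 t0 T a : wsing t0 T a (fun=> 0).
Proof.
exists 0 => //; split => s _; last by rewrite mul0r normr0.
exact: cvg_cst.
Qed.

Lemma wsingD t0 T a f g : wsing t0 T a f -> wsing t0 T a g ->
  wsing t0 T a (fun s => f s + g s).
Proof.
move=> [C C0 [cf bf]] [D D0 [cg bg]]; exists (C + D); first exact: addr_ge0.
split => s hs; first by apply: cvgD; [exact: cf|exact: cg].
by rewrite (le_trans (ler_normD _ _))// mulrDl lerD ?bf ?bg.
Qed.

Lemma wsingM t0 T a M (h : R -> R) f :
  (forall s, t0 < s < T -> {for s, continuous h}) ->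
  (forall s, t0 < s < T -> `|h s| <= M) ->
  wsing t0 T a f -> wsing t0 T a (fun s => h s * f s).
Proof.
move=> ch bh [C C0 [cf bf]]; exists (`|M| * C); first by rewrite mulr_ge0.
split => s hs; first by apply: cvgM; [exact: ch|exact: cf].
by rewrite normrM -mulrA ler_pM ?bf// (le_trans (bh _ hs))// ler_norm.
Qed.

Lemma wsingZ t0 T a c f : wsing t0 T a f -> wsing t0 T a (fun s => c * f s).
Proof.
by apply: (@wsingM _ _ _ `|c|) => // s _; exact: cvg_cst.
Qed.

Lemma wsing_sum t0 T a (I : Type) (r : seq I) (F : I -> R -> R) :
  (forall i, wsing t0 T a (F i)) -> wsing t0 T a (fun s => \sum_(i <- r) F i s).
Proof.
move=> wF; elim: r => [|i r IH].
  by under eq_fun do rewrite big_nil; exact: wsing0.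
by under eq_fun do rewrite big_cons; exact: wsingD.
Qed.

Lemma wsing_exists t0 t a b f : 0 < a <= 1 -> 0 < b <= 1 ->
  wsing t0 t a f -> RLint_exists t0 b f t.
Proof. by move=> ha hb [C _ wf]; exact: wsing_by_RLint_exists wf. Qed.

Lemma wsing_RLint t0 T a b f : 0 < a <= 1 -> 0 < b <= 1 ->
  wsing t0 T a f -> wsing t0 T a (RLint t0 b f).
Proof.
move=> ha hb [C C0 wf]; eexists; last exact: wsing_by_RLint wf.
by rewrite !mulr_ge0 ?powR_ge0// fine_ge0// ebeta_ge0.
Qed.

Lemma RLintD t0 t b f g : RLint_exists t0 b f t -> RLint_exists t0 b g t ->
  RLint t0 b (fun s => f s + g s) t = RLint t0 b f t + RLint t0 b g t.
Proof.
move=> ef eg; rewrite [in LHS]/RLint.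
under eq_Rintegral do rewrite /RL_kernel mulrDr.
by rewrite RintegralD// mulrDr.
Qed.

Lemma RLintZ t0 t b c f : RLint_exists t0 b f t ->
  RLint t0 b (fun s => c * f s) t = c * RLint t0 b f t.
Proof.
move=> ef; rewrite [in LHS]/RLint.
under eq_Rintegral do rewrite /RL_kernel mulrCA.
by rewrite RintegralZl// mulrCA.
Qed.

Lemma RLint0 t0 t b : RLint t0 b (fun=> 0) t = 0.
Proof.
rewrite /RLint (@eq_Rintegral _ _ _ _ _ (fun=> 0)).
  by rewrite Rintegral_cst// mul0r mulr0.
by move=> s _; rewrite /RL_kernel mulr0.
Qed.

Lemma RLint_sum t0 t a b (I : Type) (r : seq I) (F : I -> R -> R) :
  0 < a <= 1 -> 0 < b <= 1 -> (forall i, wsing t0 t a (F i)) ->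
  RLint t0 b (fun s => \sum_(i <- r) F i s) t =
  \sum_(i <- r) RLint t0 b (F i) t.
Proof.
move=> ha hb wF; elim: r => [|i r IH].
  by under eq_fun do rewrite big_nil; rewrite RLint0 big_nil.
under eq_fun do rewrite big_cons.
rewrite RLintD ?IH ?big_cons//; first exact: (wsing_exists ha hb (wF i)).
exact: (wsing_exists ha hb (wsing_sum r wF)).
Qed.

(** The scalar factor of the first term of the Peano-Baker series. *)
Definition fundamental a t0 : R -> R := fun t => (t - t0) `^ (a - 1) / Gamma a.

Lemma wsing_fundamental a t0 T : 0 < a < 1 -> wsing t0 T a (fundamental a t0).
Proof.
move=> /Gamma_onem_beta[Ga _ _]; exists (Gamma a)^-1; first by rewrite invr_ge0 ltW.
split => s /andP[s0 _].
  apply: cvgMr_tmp.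
  apply: (@continuous_comp _ _ _ (fun x => x - t0) (fun x : R => x `^ (a - 1))).
    by apply: cvgB; [exact: cvg_id|exact: cvg_cst].
  by apply: powR_continuous; rewrite subr_gt0.
rewrite /fundamental -tpowE ?subr_gt0// mulrC ger0_norm// mulr_ge0 ?tpow_ge0//.
by rewrite invr_ge0 ltW.
Qed.

(** The integrand is a multiple of the beta integrand with exponents summing to
    1, whose integral does not depend on t. *)
Lemma RLint_fundamental a t0 t : 0 < a < 1 -> t0 < t ->
  RLint t0 (1 - a) (fundamental a t0) t = 1.
Proof.
move=> /[dup] ha1 /andP[a0 a1] t0t.
have ha : 0 < a <= 1 by rewrite a0 ltW.
have hb : 0 < 1 - a <= 1 by rewrite subr_gt0 a1 gerBl ltW.
have [Ga Gb GM] := Gamma_onem_beta ha1.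
rewrite /RLint Rintegral_mkcond.
have -> : RL_kernel (1 - a) (fundamental a t0) t \_ `]t0, t[ =
    (fun s : R => (Gamma a)^-1 * (tpow (1 - a) (t - s) * tpow a (s - t0))).
  apply/funext => s; rewrite patchE mem_setE in_itv/=.
  have [st0|t0s] := leP s t0; first by rewrite [tpow a _]tpow_le0 ?subr_le0// !mulr0.
  have [ts|st] := leP t s; first by rewrite [tpow (1 - a) _]tpow_le0 ?subr_le0// mul0r mulr0.
  by rewrite /RL_kernel /fundamental -!tpowE ?subr_gt0//= [LHS]mulrA mulrC.
rewrite RintegralZl//; last exact: integrable_beta.
rewrite /Rintegral tpow_convolution//= subrK tpow1 ?subr_gt0// mul1r -GM.
have Ga0 : Gamma a != 0 by rewrite (gt_eqF Ga).
have Gb0 : Gamma (1 - a) != 0 by rewrite (gt_eqF Gb).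
by rewrite mulrCA (mulKf Gb0) (mulVf Ga0).
Qed.

Lemma is_derive_primitive t0 T a f t :
  0 < a <= 1 -> wsing t0 T a f -> t0 < t < T ->
  is_derive t 1 (fun t => \int[mu]_(s in `]t0, t[) f s) (f t).
Proof.
move=> ha [C C0 wf] /andP[t0t tT].
pose u := (t + T) / 2.
have tu : t < u by rewrite /u midf_lt.
have uT : u < T by rewrite /u midf_lt.
have intT := wsing_by_integrable ha wf.
have intu : mu.-integrable `]t0, u] (EFin \o f).
  apply: integrableS intT; [exact: measurable_itv|exact: measurable_itv|].
  by move=> x; rewrite /= !in_itv/= => /andP[-> xu]; exact: (le_lt_trans xu uT).
have cf : {for t, continuous f} by apply: wf.1; rewrite t0t.
have [d1 d2] := @continuous_FTC1 R f (BRight t0) t u tu intu t0t cf.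
apply: (@near_eq_is_derive _ _ _ (fun x => \int[mu]_(s in `]t0, x]) f s)).
  near=> x; rewrite -Rintegral_itv_bndo_bndc//.
  apply: wsing_by_integrable ha (wsing_by_sub _ wf).
  by apply: ltW; near: x; exact: lt_nbhsl.
by split; [exact: d1|rewrite -derive1E].
Unshelve. all: end_near. Qed.

Definition uniform_on t0 T (F : nat -> R -> R) f := forall e, 0 < e ->
  \forall N \near \oo, forall s, t0 < s < T -> `|F N s - f s| <= e.

(** On a bounded interval a constant is itself weakly singular, since
    s - t0 <= T - t0; a uniform error e thus has a singular bound that is
    proportional to e. *)
Lemma bound_tpow t0 T a e s : 0 < a <= 1 -> 0 <= e -> t0 < s < T ->
  e <= (e * (T - t0) `^ (1 - a)) * tpow a (s - t0).
Proof.
move=> /andP[a0 a1] e0 /andP[s0 sT].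
rewrite -mulrA ler_peMr// tpowE ?subr_gt0//.
rewrite -(opprB 1 a) powRN -ler_pdivrMr ?invr_gt0 ?powR_gt0 ?subr_gt0// invrK mul1r.
have s0' := ltW s0; have sT' := ltW sT.
apply: ge0_ler_powR; rewrite ?nnegrE ?subr_ge0 ?lerB//.
exact: le_trans sT'.
Qed.

(** The usual epsilon/3 argument; the bound is that of an approximant at
    distance 1. *)
Lemma wsing_limit t0 T a F f : 0 < a <= 1 -> (forall N, wsing t0 T a (F N)) ->
  uniform_on t0 T F f -> wsing t0 T a f.
Proof.
move=> ha wF uF.
have [N NP] : exists N, forall s, t0 < s < T -> `|F N s - f s| <= 1.
  by have [N _ NP] := uF 1 ltr01; exists N; apply: NP => /=.
have [C C0 [_ bF]] := wF N.
exists (C + 1 * (T - t0) `^ (1 - a)).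
  by rewrite addr_ge0// mulr_ge0// powR_ge0.
split => s hs; last first.
  rewrite -[f s](subrK (F N s)) (le_trans (ler_normD _ _))// addrC mulrDl.
  rewrite lerD ?bF// distrC (le_trans (NP _ hs))//.
  exact: bound_tpow.
apply/(@cvgrPdist_le _ R^o) => e e0.
have e3 : 0 < e / 3 by rewrite divr_gt0.
have [M MP] : exists M, forall s, t0 < s < T -> `|F M s - f s| <= e / 3.
  by have [M _ MP] := uF _ e3; exists M; apply: MP => /=.
have [_ _ [cF _]] := wF M.
have /(@cvgrPdist_le _ R^o)/(_ _ e3) cFM := cF s hs.
have /andP[s0 sT] := hs.
near=> x.
have hx : t0 < x < T.
  by apply/andP; split; near: x; [exact: lt_nbhsr|exact: lt_nbhsl].
have -> : f s - f x = (f s - F M s) + (F M s - F M x) + (F M x - f x) by ring.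
rewrite (le_trans (ler_normD _ _))// (le_trans (lerD (ler_normD _ _) (lexx _)))//.
have -> : e = e / 3 + e / 3 + e / 3 by field.
rewrite !lerD ?MP//; first by rewrite distrC MP.
by near: x.
Unshelve. all: end_near. Qed.

(** The difference has a singular bound proportional to the uniform error, and
    the fractional integral is bounded by a constant times that bound. *)
Lemma RLint_limit t0 t a b F f : 0 < a <= 1 -> 0 < b <= 1 ->
  (forall N, wsing t0 t a (F N)) -> wsing t0 t a f -> uniform_on t0 t F f ->
  RLint t0 b (F N) t @[N --> \oo] --> RLint t0 b f t.
Proof.
move=> ha hb wF wf uF.
pose K := `|(Gamma b)^-1| * ((t - t0) `^ (1 - a) * (tpow (b + a) (t - t0) * beta b a)).
have K0 : 0 <= K.
  by rewrite !mulr_ge0 ?powR_ge0 ?tpow_ge0// fine_ge0// ebeta_ge0.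
apply/(@cvgrPdist_le _ R^o) => e e0.
have eK : 0 < e / (K + 1) by rewrite divr_gt0// ltr_wpDl.
near=> N.
have NP : forall s, t0 < s < t -> `|F N s - f s| <= e / (K + 1).
  by near: N; exact: uF.
have eF := wsing_exists ha hb (wF N).
have ef := wsing_exists ha hb wf.
have wD : wsing_by t0 t a (e / (K + 1) * (t - t0) `^ (1 - a)) (fun s => F N s + -1 * f s).
  have [D D0 [cD _]] := wsingD (wF N) (wsingZ (-1) wf).
  split => // s hs; rewrite mulN1r (le_trans (NP _ hs))//.
  by apply: bound_tpow => //; exact: ltW.
rewrite distrC -[- RLint _ _ _ _]mulN1r -RLintZ// -RLintD//; last first.
  exact: (wsing_exists ha hb (wsingZ (-1) wf)).
have C0 : 0 <= e / (K + 1) * (t - t0) `^ (1 - a) by rewrite mulr_ge0 ?powR_ge0 ?ltW.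
rewrite (le_trans (RLint_bound ha hb C0 wD))//.
rewrite -[X in _ * X]mulrA mulrCA -/K mulrAC ler_pdivrMr ?ltr_wpDl//.
by rewrite ler_wpM2l ?ltW// ltrDl.
Unshelve. all: end_near. Qed.

End Linear.

(** * The generalized Peano-Baker series *)

Section PeanoBaker.
Context {R : realType} {n : nat} {a : R} {I : set R} {t0 : R}.
Context {A : R -> 'M[R]_n}.
Hypotheses (ha1 : 0 < a < 1) (itvI : is_interval I) (It0 : I t0).
Hypothesis cA : {within I, continuous A}.
Notation S := (PB_partial_sum a A t0).

Let ha : 0 < a <= 1. Proof. by case/andP: ha1 => -> /ltW ->. Qed.

Lemma after_sub T : after I t0 T -> `[t0, T]%classic `<=` I.
Proof.
move=> [IT t0T] s; rewrite /= in_itv/= => hs; exact: (itvI It0 IT).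
Qed.

Lemma coefficient_within T i j : after I t0 T ->
  {within `[t0, T], continuous (fun s => A s i j)}.
Proof.
move=> hT; have cAT := continuous_subspaceW (after_sub hT) cA.
move=> x; apply: (@continuous_comp _ _ _ (A : subspace `[t0, T] -> 'M[R]_n)
  (fun M : 'M[R]_n => M i j)).
  exact: cAT.
exact: coord_continuous.
Qed.

Lemma coefficient_continuous T i j : after I t0 T ->
  forall s, t0 < s < T -> {for s, continuous (fun s => A s i j)}.
Proof.
move=> hT s hs; case: (hT) => _ t0T.
have /(continuous_within_itvP _ t0T)[cT _ _] := @coefficient_within T i j hT.
by apply: cT; rewrite in_itv/=.
Qed.

(** The segment [t0, T] is compact and contained in I. *)
Lemma coefficient_bounded T i j : after I t0 T ->
  exists M, forall s, t0 < s < T -> `|A s i j| <= M.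
Proof.
move=> hT; case: (hT) => _ t0T.
have cT : {within `[t0, T], continuous (fun s => `|A s i j|)}.
  move=> x.
  apply: (@continuous_comp _ _ _ (fun s : subspace `[t0, T] => A s i j) Num.norm).
    exact: coefficient_within.
  exact: norm_continuous.
have [c _ cmax] := EVT_max (ltW t0T) cT.
exists `|A c i j| => s /andP[s0 sT]; apply: cmax.
by rewrite in_itv/= (ltW s0) ltW.
Qed.

Lemma wsing_coefficientM T i j f : after I t0 T -> wsing t0 T a f ->
  wsing t0 T a (fun s => A s i j * f s).
Proof.
move=> hT; have [M AM] := coefficient_bounded i j hT.
exact: wsingM (@coefficient_continuous T i j hT) AM.
Qed.

Definition wsing_mx T p q (X : R -> 'M[R]_(p, q)) :=
  forall i j, wsing t0 T a (fun s => X s i j).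

Lemma wsing_mulmx T p (X : R -> 'M[R]_(n, p)) : after I t0 T ->
  wsing_mx T X -> wsing_mx T (fun s => A s *m X s).
Proof.
move=> hT wX i j; under eq_fun do rewrite mxE.
by apply: wsing_sum => k; exact: wsing_coefficientM.
Qed.

Lemma wsing_PB_term T k : after I t0 T -> wsing_mx T (PB_term a A t0 k).
Proof.
move=> hT; elim: k => [|k IH] i j /=.
  under eq_fun do rewrite mxE -mulr_natl.
  by apply: wsingZ; exact: wsing_fundamental.
under eq_fun do rewrite mxE.
by apply: wsing_RLint => //; exact: wsing_mulmx.
Qed.

Lemma PB_partial_sumE N t i j :
  S N t i j = \sum_(0 <= k < N) PB_term a A t0 k t i j.
Proof. by rewrite /PB_partial_sum summxE. Qed.

Lemma wsing_PB_partial_sum T N : after I t0 T -> wsing_mx T (S N).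
Proof.
move=> hT i j; under eq_fun do rewrite PB_partial_sumE.
by apply: wsing_sum => k; exact: wsing_PB_term.
Qed.

(** Each term is obtained from its predecessor by f |-> J^alpha (A f), which is
    linear. *)
Lemma PB_partial_sumS T N t i j : after I t0 T -> t0 < t <= T ->
  S N.+1 t i j = (fundamental a t0 t *+ (i == j)) +
    RLint t0 a (fun s => (A s *m S N s) i j) t.
Proof.
move=> hT /andP[t0t tT].
rewrite PB_partial_sumE big_nat_recl//=; congr (_ + _).
  by rewrite mxE.
under eq_bigr do rewrite mxE.
rewrite -(@RLint_sum _ t0 t a a _ (index_iota 0 N)
  (fun k s => (A s *m PB_term a A t0 k s) i j))//.
  congr RLint; apply/funext => s.
  by rewrite /PB_partial_sum mulmx_sumr summxE.
by move=> k; apply: wsing_sub tT _; exact: (wsing_mulmx hT (wsing_PB_term k hT)).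
Qed.

Variable Phi : R -> 'M[R]_n.
Hypothesis uS : {uniform after I t0, S @ \oo --> Phi}.

Lemma PB_uniform_on T i j : after I t0 T ->
  uniform_on t0 T (fun N s => S N s i j) (fun s => Phi s i j).
Proof.
move=> hT e e0.
have : nbhs (Phi : {uniform` after I t0 -> _}) 
    [set h : {uniform` after I t0 -> _} |
      forall s, after I t0 s -> ball (Phi s) e (h s)].
  apply/uniform_nbhs.
  exists [set xy : 'M[R]_n * 'M[R]_n | ball xy.1 e xy.2]; split => //.
  exact: (entourage_ball _ (PosNum e0)).
move=> /uS [N _ NP]; exists N => // m Nm s /andP[t0s sT].
case: (hT) => IT _; have sI : after I t0 s.
  by split=> //; apply: (itvI It0 IT); rewrite !ltW.
by have [_ /(_ i j)] := NP m Nm s sI; rewrite /ball/= distrC => /ltW.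
Qed.

Lemma wsing_transition T : after I t0 T -> wsing_mx T Phi.
Proof.
move=> hT i j; apply: (wsing_limit ha _ (PB_uniform_on i j hT)) => N.
exact: wsing_PB_partial_sum.
Qed.

Lemma uniform_on_mulmx T i j : after I t0 T ->
  uniform_on t0 T (fun N s => (A s *m S N s) i j) (fun s => (A s *m Phi s) i j).
Proof.
move=> hT e e0.
have /choice[M MA] := fun k => @coefficient_bounded T i k hT.
pose B := \sum_k `|M k|.
have B0 : 0 <= B by exact: sumr_ge0.
have eB : 0 < e / (B + 1) by rewrite divr_gt0// ltr_wpDl.
have : \forall N \near \oo, forall k, forall s, t0 < s < T ->
    `|S N s k j - Phi s k j| <= e / (B + 1).
  by apply: filter_forall => k; exact: PB_uniform_on.
apply: filterS => N NP s hs.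
rewrite !mxE -sumrB (le_trans (ler_norm_sum _ _ _))//.
apply: (@le_trans _ _ (\sum_k `|M k| * (e / (B + 1)))).
  apply: ler_sum => k _; rewrite -mulrBr normrM ler_pM ?NP//.
  by rewrite (le_trans (MA k _ hs))// ler_norm.
rewrite -mulr_suml -/B mulrCA ler_piMr//; first exact: ltW.
by rewrite ler_pdivrMr ?ltr_wpDl// mul1r lerDl.
Qed.

(** Let N tend to infinity in both sides of the recurrence for the partial
    sums. *)
Lemma Volterra_equation T t i j : after I t0 T -> t0 < t < T ->
  Phi t i j = (fundamental a t0 t *+ (i == j)) +
    RLint t0 a (fun s => (A s *m Phi s) i j) t.
Proof.
move=> hT ht; have [t0t tT] := andP ht.
have cS : S N.+1 t i j @[N --> \oo] --> Phi t i j.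
  apply/(@cvgrPdist_le _ R^o) => e e0.
  have := PB_uniform_on i j hT e0.
  move=> [N _ NP]; exists N => // m Nm.
  by rewrite /= distrC NP//=; exact: leqW.
have cJ : RLint t0 a (fun s => (A s *m S N s) i j) t @[N --> \oo] -->
    RLint t0 a (fun s => (A s *m Phi s) i j) t.
  apply: (@RLint_limit _ t0 t a) => //.
  - move=> N; apply: wsing_sub (ltW tT) _.
    exact: (wsing_mulmx hT (wsing_PB_partial_sum N hT)).
  - by apply: wsing_sub (ltW tT) _; exact: (wsing_mulmx hT (wsing_transition hT)).
  - move=> e /(uniform_on_mulmx i j hT); apply: filterS => N NP s /andP[t0s st].
    by apply: NP; rewrite t0s (lt_trans st).
have cR : S N.+1 t i j @[N --> \oo] --> (fundamental a t0 t *+ (i == j)) +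
    RLint t0 a (fun s => (A s *m Phi s) i j) t.
  under eq_fun do rewrite (PB_partial_sumS _ _ _ hT) ?t0t ?ltW//.
  by apply: (@cvgD _ R^o) => //; exact: cvg_cst.
exact: (cvg_unique _ cS cR).
Qed.

Variable x0 : 'cV[R]_n.
Let x t : 'cV[R]_n := Phi t *m x0.

Lemma wsing_solution T : after I t0 T -> wsing_mx T x.
Proof.
move=> hT i j; rewrite /x; under eq_fun do rewrite mxE.
apply: wsing_sum => k; under eq_fun do rewrite mulrC.
by apply: wsingZ; exact: wsing_transition.
Qed.

Lemma Volterra_equation_solution T t i : after I t0 T -> t0 < t < T ->
  x t i 0 = fundamental a t0 t * x0 i 0 +
    RLint t0 a (fun s => (A s *m x s) i 0) t.
Proof.
move=> hT ht; have [t0t tT] := andP ht.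
rewrite mxE.
under eq_bigr do rewrite (Volterra_equation _ _ hT ht) mulrDl.
rewrite big_split/=; congr (_ + _).
  rewrite (bigD1 i)//= eqxx mulr1n big1 ?addr0// => k ki.
  by rewrite eq_sym (negbTE ki) mulr0n mul0r.
have w k : wsing t0 t a (fun s => (A s *m Phi s) i k).
  by apply: wsing_sub (ltW tT) _; exact: (wsing_mulmx hT (wsing_transition hT)).
transitivity (\sum_k RLint t0 a (fun s => x0 k 0 * (A s *m Phi s) i k) t).
  apply: eq_bigr => k _; rewrite RLintZ; first exact: mulrC.
  exact: (wsing_exists ha ha (w k)).
rewrite -(@RLint_sum _ t0 t a)//; last by move=> k; exact: wsingZ.
congr RLint; apply/funext => s; rewrite /x mulmxA [RHS]mxE.
by apply: eq_bigr => k _; rewrite mulrC.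
Qed.

(** The integrated form of the initial value problem. *)
Lemma RLint_solution T t i : after I t0 T -> t0 < t < T ->
  RLint t0 (1 - a) (fun s => x s i 0) t =
  x0 i 0 + \int[lebesgue_measure]_(s in `]t0, t[) (A s *m x s) i 0.
Proof.
move=> hT ht; have [t0t tT] := andP ht.
have hb : 0 < 1 - a <= 1.
  by case/andP: ha1 => a0 a1; rewrite subr_gt0 a1 gerBl ltW.
have wAx : wsing t0 t a (fun s => (A s *m x s) i 0).
  by apply: wsing_sub (ltW tT) _; exact: (wsing_mulmx hT (wsing_solution hT)).
have wg := wsing_fundamental t0 t ha1.
rewrite (RLint_ext _ (g := fun s => x0 i 0 * fundamental a t0 s +
  RLint t0 a (fun s => (A s *m x s) i 0) s)); last first.
  move=> s /andP[t0s st]; rewrite (Volterra_equation_solution _ hT) 1?mulrC// t0s.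
  exact: lt_trans tT.
rewrite RLintD; last 2 first.
- exact: wsing_exists (wsingZ _ wg).
- exact: wsing_exists (wsing_RLint ha ha wAx).
rewrite RLintZ; last exact: wsing_exists wg.
rewrite RLint_fundamental// mulr1; congr (_ + _).
by case: wAx => C C0 wAx; exact: RLint_semigroup wAx.
Qed.

Lemma interior_after t : I° t -> t0 < t -> exists2 T, after I t0 T & t < T.
Proof.
move=> It t0t.
have /nbhs_ballP[e /= e0 eI] : nbhs t I by [].
have te : t < t + e / 2 by rewrite ltrDl divr_gt0.
exists (t + e / 2) => //; split; last exact: lt_trans te.
apply: eI; rewrite /ball/= opprD addNKr normrN gtr0_norm ?divr_gt0//.
by rewrite ltr_pdivrMr// ltr_pMr// ltr1n.
Qed.

(** At an interior point the identity of [RLint_solution] holds on a whole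
    neighbourhood, so it may be differentiated. *)
Lemma is_derive_RLint_solution t i : I° t -> t0 < t ->
  is_derive t 1 (RLint t0 (1 - a) (fun s => x s i 0)) ((A t *m x t) i 0).
Proof.
move=> It t0t; have [T hT tT] := interior_after It t0t.
apply: (@near_eq_is_derive _ _ _ (fun t => x0 i 0 +
   \int[lebesgue_measure]_(s in `]t0, t[) (A s *m x s) i 0)).
  near=> u; rewrite (RLint_solution _ hT)//.
  by apply/andP; split; near: u; [exact: lt_nbhsr|exact: lt_nbhsl].
have := is_derive_primitive ha (wsing_mulmx hT (wsing_solution hT) i 0) (t := t).
rewrite t0t tT => /(_ isT) dp.
rewrite -[X in is_derive _ _ _ X]add0r.
by apply: is_deriveD.
Unshelve. all: end_near. Qed.

(** The integral of A x over ]t0, t[ is O((t - t0)^alpha).  If no point of I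
    lies beyond t0 the limit is along a trivial filter. *)
Lemma RLint_solution_initial :
  RLint_mx t0 (1 - a) x t @[t --> within (after I t0) (nbhs t0)] --> x0.
Proof.
apply/cvg_ballP => e e0.
suff : \forall t \near within (after I t0) (nbhs t0),
    forall i : 'I_n, `|x0 i 0 - RLint t0 (1 - a) (fun s => x s i 0) t| < e.
  apply: filterS => t Pt; split => // i j.
  by rewrite (ord1 j) mxE; exact: Pt.
apply: filter_forall => i.
have [[T hT]|noT] := pselect (exists T, after I t0 T); last first.
  by rewrite near_withinE; apply: nearW => t It; case: noT; exists t.
have [C C0 wAx] := wsing_mulmx hT (wsing_solution hT) i 0.
have a0 : 0 < a by case/andP: ha1.
have c0 : C * beta 1 a * y `^ a @[y --> 0^'+] --> C * beta 1 a * 0.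
  by apply: cvgMl_tmp; exact: powR_cvg0.
rewrite mulr0 in c0.
have /(@cvgrPdist_lt _ R^o)/(_ _ e0) := c0.
move=> [d /= d0 dP].
have t0T : t0 < T by case: hT.
have : \forall t \near t0, t < T /\ `|t0 - t| < d.
  near=> t; split; first by near: t; exact: lt_nbhsl.
  by near: t; exists d.
apply: filterS => t [tT td] [_ t0t].
rewrite (RLint_solution _ hT) ?t0t// opprD addNKr normrN.
apply: le_lt_trans (Rintegral_bound ha C0 t0t (wsing_by_sub (ltW tT) wAx)) _.
have := dP (t - t0); rewrite /ball_/= !sub0r !normrN => /(_ _ _).
rewrite subr_gt0 t0t -(normrN (t - t0)) opprB => /(_ td isT).
by apply: le_lt_trans; exact: ler_norm.
Unshelve. all: end_near. Qed.

End PeanoBaker.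

Unset Implicit Arguments.

Theorem theorem2 (R : realType) (n : nat) (alpha : R) (I : set R) (t0 : R)
    (A : R -> 'M[R]_n) (x0 : 'cV[R]_n) :
  0 < alpha -> alpha < 1 ->
  is_interval I -> I t0 ->
  {within I, continuous A} ->
  {uniform after I t0, PB_partial_sum alpha A t0 @ \oo -->
                       (fun t => state_transition alpha A t t0)} ->
  RL_ivp_solution alpha I t0 A x0 (fun t => state_transition alpha A t t0 *m x0).
Proof.
move=> a0 a1 itvI It0 cA uS.
have ha1 : 0 < alpha < 1 by rewrite a0.
have ha : 0 < alpha <= 1 by rewrite a0 ltW.
have hb : 0 < 1 - alpha <= 1 by rewrite subr_gt0 a1 gerBl ltW.
have deriv t i : I° t -> t0 < t -> is_derive t 1
    (RLint t0 (1 - alpha) (fun s => (state_transition alpha A s t0 *m x0) i 0))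
    ((A t *m (state_transition alpha A t t0 *m x0)) i 0).
  exact: (is_derive_RLint_solution ha1 itvI It0 cA uS).
split.
- move=> t hT i; apply: (wsing_exists ha hb).
  exact: (wsing_solution ha1 itvI It0 cA uS).
- by move=> t It t0t i; case: (deriv t i It t0t).
- move=> t It t0t; apply/matrixP => i j; rewrite (ord1 j) mxE.
  by rewrite /RLderive derive1E; case: (deriv t i It t0t).
- exact: (RLint_solution_initial ha1 itvI It0 cA uS).
Qed.
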